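(* For every even integer $k\ge 2$, $$GR_k(F_3)\ \ge\ \begin{cases} 14, & \text{if } k=2;\\ 14\cdot 5^{\frac{k-2}{2}}+1, & \text{if } k\ge 4.\end{cases}$$
   Context: Graphs are finite and simple. $F_3=K_1+3K_2$ is the fan obtained from a matching of three disjoint edges by adding one new vertex adjacent to all six vertices of the matching (three triangles sharing exactly one common vertex). A Gallai coloring is an edge coloring that contains no rainbow triangle, i.e. no triangle whose three edges have three pairwise different colors. For a graph $G$ and a positive integer $k$, the Gallai-Ramsey number $GR_k(G)$ is the smallest positive integer $N$ such that every Gallai coloring $\tau:E(K_N)\to\{1,\dots,k\}$ (not all colors need be used) contains a monochromatic subgraph isomorphic to $G$. *)

(* Defs.v *)
From mathcomp Require Import all_boot.

Set Implicit Arguments.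
Unset Strict Implicit.
Unset Printing Implicit Defensive.

Record sgraph := SGraph {
  vertex :> finType;
  adj : rel vertex;
  adj_sym : symmetric adj;
  adj_irrefl : irreflexive adj }.

(* [matching n] is nK_2: the i-th edge joins (i, false) and (i, true). *)
Definition matching_adj (n : nat) : rel ('I_n * bool) :=
  fun u v => (u.1 == v.1) && (u.2 != v.2).

Lemma matching_adj_sym n : symmetric (@matching_adj n).
Proof. by move=> u v; rewrite /matching_adj eq_sym [u.2 == _]eq_sym. Qed.

Lemma matching_adj_irrefl n : irreflexive (@matching_adj n).
Proof. by move=> u; rewrite /matching_adj !eqxx. Qed.

Definition matching (n : nat) : sgraph :=
  SGraph (@matching_adj_sym n) (@matching_adj_irrefl n).

(* [cone G] is the join K_1 + G; the new vertex is [None]. *)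
Definition cone_adj (G : sgraph) : rel (option G) :=
  fun u v => match u, v with
             | Some x, Some y => adj x y
             | None, None => false
             | _, _ => true
             end.

Lemma cone_adj_sym G : symmetric (@cone_adj G).
Proof. by move=> [x|] [y|] //=; exact: adj_sym. Qed.

Lemma cone_adj_irrefl G : irreflexive (@cone_adj G).
Proof. by move=> [x|] //=; exact: adj_irrefl. Qed.

Definition cone (G : sgraph) : sgraph :=
  SGraph (@cone_adj_sym G) (@cone_adj_irrefl G).

Definition fan (n : nat) : sgraph := cone (matching n).

(* The edge xy of the complete graph on V is the set [set x; y] with x != y;
   the values of a coloring on sets that are not of this form are never used. *)
Definition coloring (k : nat) (V : finType) := {ffun {set V} -> 'I_k}.

Definition gallai k (V : finType) (tau : coloring k V) : bool :=
  [forall x, forall y, forall z, uniq [:: x; y; z] ==>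
    ~~ uniq [:: tau [set x; y]; tau [set y; z]; tau [set x; z]]].

(* The copy of G need not be induced. *)
Definition has_mono k (V : finType) (tau : coloring k V) (G : sgraph) : bool :=
  [exists c : 'I_k, exists f : {ffun G -> V},
    injectiveb f &&
    [forall x, forall y, adj x y ==> (tau [set f x; f y] == c)]].

Definition gallai_ramsey (k : nat) (G : sgraph) (N : nat) : bool :=
  [forall tau : coloring k 'I_N, gallai tau ==> has_mono tau G].

Lemma ramsey_clique k (s : 'I_k -> nat) : 0 < k ->
  exists N, forall (V : finType) (tau : coloring k V) (A : {set V}),
    N <= #|A| -> exists c, exists B : {set V},
      #|B| = s c /\ {in B &, forall x y, x != y -> tau [set x; y] = c}.
Proof.
move=> k0.
suff H n : forall s : 'I_k -> nat, \sum_i s i <= n ->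
  exists N, forall (V : finType) (tau : coloring k V) (A : {set V}),
    N <= #|A| -> exists c, exists B : {set V},
      [/\ B \subset A, #|B| = s c &
          {in B &, forall x y, x != y -> tau [set x; y] = c}].
  have [N HN] := H _ s (leqnn _); exists N => V tau A /HN-/(_ tau).
  by move=> [c [B [_ ? ?]]]; exists c, B.
elim: n => [|n IH] {}s sn.
  exists 0 => V tau A _; exists (Ordinal k0), set0.
  split; rewrite ?sub0set ?cards0 //; last by move=> x y; rewrite inE.
  by move: sn; rewrite leqn0 sum_nat_eq0 => /forallP/(_ (Ordinal k0))/eqP.
have [/existsP[c /eqP sc]|/existsPn s0] := boolP [exists c, s c == 0].
  exists 0 => V tau A _; exists c, set0.
  by split; rewrite ?sub0set ?cards0 //; move=> x y; rewrite inE.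
pose s' c i := if i == c then (s i).-1 else s i.
have s'n c : \sum_i s' c i <= n.
  rewrite -ltnS; apply: leq_trans sn.
  rewrite (bigD1 c) //= [X in _ < X](bigD1 c) //= /s' eqxx -addSn prednK ?lt0n //.
  by rewrite leq_add2l leq_sum // => i /negPf->.
have [F HF] := fin_all_exists (fun c => IH _ (s'n c)).
exists (\sum_c F c).+1 => V tau A HA.
have /card_gt0P[x xA] : 0 < #|A| by apply: leq_trans HA.
pose C c := [set y in A :\ x | tau [set x; y] == c].
have [c FC] : exists c, F c <= #|C c|.
  apply/existsP; apply: contraLR HA => /existsPn HC.
  rewrite -ltnNge ltnS (cardsD1 x) xA add1n.
  have -> : #|A :\ x| = \sum_c #|C c|.
    rewrite -sum1_card (partition_big (fun y => tau [set x; y]) xpredT) //=.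
    apply: eq_bigr => c _; rewrite -sum1_card.
    by apply: eq_bigl => y; rewrite !inE.
  rewrite (bigD1 (Ordinal k0)) //= [X in _ < X](bigD1 (Ordinal k0)) //=.
  rewrite -addSn leq_add // ?ltnNge ?HC //.
  by apply: leq_sum => i _; rewrite ltnW // ltnNge HC.
have [d [B [BC Bd HB]]] := HF c V tau (C c) FC.
have BA : B \subset A.
  by apply: subset_trans BC _; apply/subsetP => y; rewrite !inE => /andP[/andP[]].
move: Bd; rewrite /s'; case: eqP => [dc|_] Bd; last by exists d, B.
have xB : x \notin B.
  by apply/negP => /(subsetP BC); rewrite !inE eqxx.
exists d, (x |: B); split.
- by rewrite subUset sub1set xA.
- by rewrite cardsU1 xB Bd add1n prednK // lt0n s0.
have Hx y : y \in B -> tau [set x; y] = d.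
  by move=> /(subsetP BC); rewrite !inE => /andP[_ /eqP]; rewrite dc.
move=> u v /setU1P[->|uB] /setU1P[->|vB]; rewrite ?eqxx // => uv.
- exact: Hx.
- by rewrite setUC Hx.
- exact: HB.
Qed.

Lemma gallai_ramsey_exists k G : exists N, (0 < N) && gallai_ramsey k G N.
Proof.
case: (posnP k) => [->|k0].
  by exists 1; apply/forallP => tau; case: (tau set0).
have [N HN] := ramsey_clique (fun=> #|G|) k0.
exists N.+1; apply/forallP => tau; apply/implyP => _.
have [|c [B [BG HB]]] := HN _ tau [set: 'I_N.+1].
  by rewrite cardsT card_ord.
apply/existsP; exists c; apply/existsP.
pose f := [ffun x : G => enum_val (cast_ord (esym BG) (enum_rank x))].
have fI : injective f.
  by move=> x y; rewrite !ffunE => /enum_val_inj/cast_ord_inj/enum_rank_inj.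
exists f; apply/andP; split; first exact/injectiveP.
apply/forallP => x; apply/forallP => y; apply/implyP => xy.
apply/eqP/HB; rewrite ?(inj_eq fI); try by rewrite ffunE enum_valP.
by apply: contraTneq xy => ->; rewrite adj_irrefl.
Qed.

Definition GR (k : nat) (G : sgraph) : nat := ex_minn (gallai_ramsey_exists k G).

(* Main.v *)
(** A color class is [F_3]-free when no neighborhood contains a matching of size
    3, both taken in that color.  Color the edges of [K_5] by a 5-cycle in one
    color and the complementary 5-cycle in another, and replace its vertices by
    colored complete graphs.  As [K_5] has no monochromatic triangle, matchings
    in the [c]-neighborhood of a vertex of part [i], for an outer color [c], have
    size at most [d_i + \sum_j m_j], where [d_i] bounds the [c]-degrees inside
    part [i], [m_j] bounds the [c]-matchings inside part [j], and [j] runs over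
    the [c]-neighbors of [i].

    Blowing up by [n <= 2] vertices and four triangles, two in each outer color,
    gives [n + 12] vertices: 13 with 2 colors, and 14 if the first part is an
    edge of a third color.  Blowing up with two new colors by five such 14-vertex
    colorings gives 70 vertices and 4 colors: the new colors may be reused for
    the five exceptional edges, three in one color and two in the other.  Each
    further blow-up with two new colors multiplies the order by 5. *)

Require Import Defs.
From mathcomp Require Import all_boot.

Set Implicit Arguments.
Unset Strict Implicit.
Unset Printing Implicit Defensive.

(** * Matchings, degrees and fans in a relation *)

Section Matchings.
Variable T : eqType.
Implicit Types (e : rel T) (s : seq (T * T)).

Definition endpoints s := flatten [seq [:: p.1; p.2] | p <- s].

Definition is_matching e s :=
  uniq (endpoints s) && all (fun p => e p.1 p.2) s.

Definition match_le e m := forall s, is_matching e s -> size s <= m.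

Definition deg_le e d := forall v (r : seq T), uniq r -> all (e v) r -> size r <= d.

Definition link e v : rel T := fun x y => [&& e v x, e v y & e x y].

(** A fan with $m+1$ triangles centered at [v] is a matching of size $m+1$ in the link of [v], so
    this bound excludes [fan m.+1]. *)
Definition fan_le e m := forall v, match_le (link e v) m.

Lemma mem_endpoints s p : p \in s -> (p.1 \in endpoints s) && (p.2 \in endpoints s).
Proof.
by move=> ps; apply/andP; split; apply/flattenP; exists [:: p.1; p.2];
  rewrite ?inE ?eqxx ?orbT // map_f.
Qed.

Lemma is_matching_filter e a s : is_matching e s -> is_matching e (filter a s).
Proof.
rewrite /is_matching => /andP[us es]; apply/andP; split.
  apply: subseq_uniq us; elim: s {es} => [//|p s IH].
  rewrite [filter a _]/=; case: (a p).
    exact: cat_subseq (subseq_refl [:: p.1; p.2]) IH.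
  exact: subseq_trans IH (suffix_subseq [:: p.1; p.2] _).
by apply/allP => p; rewrite mem_filter => /andP[_ /(allP es)].
Qed.

Lemma is_matching_mono e e' s :
  {in s, forall p, e p.1 p.2 -> e' p.1 p.2} -> is_matching e s -> is_matching e' s.
Proof.
move=> ee' /andP[us es]; rewrite /is_matching us /=.
by apply/allP => p ps; apply/ee'/(allP es).
Qed.

(** Picking one end of each edge turns the matching edges that meet a given part into distinct
    neighbors, which a degree bound can count. *)
Lemma uniq_one_endpoint s (a : pred (T * T)) :
  uniq (endpoints s) -> uniq [seq if a p then p.1 else p.2 | p <- s].
Proof.
elim: s => //= p s IH /and3P[]; rewrite inE => /norP[_ p1] p2 /IH->.
rewrite andbT; apply/negP => /mapP[q /mem_endpoints/andP[q1 q2]].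
by case: (a p) p1 p2; case: (a q) => p1 p2 Dq; rewrite Dq ?q1 ?q2 in p1 p2.
Qed.

Lemma size_endpoints s : size (endpoints s) = (size s).*2.
Proof. by elim: s => //= p s ->. Qed.

Lemma match_leW e m n : m <= n -> match_le e m -> match_le e n.
Proof. by move=> mn em s /em/leq_trans; apply. Qed.

Lemma deg_leW e m n : m <= n -> deg_le e m -> deg_le e n.
Proof. by move=> mn em v s us /(em _ _ us)/leq_trans; apply. Qed.

Lemma match_fan_le e m : match_le e m -> fan_le e m.
Proof.
by move=> em v s ms; apply/em/(is_matching_mono _ ms) => p _ /and3P[].
Qed.

End Matchings.

Lemma is_matching_map (T T' : eqType) (g : T -> T') (e' : rel T') (s : seq (T * T)) :
  uniq (endpoints s) -> {in endpoints s &, injective g} ->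
  {in s, forall p, e' (g p.1) (g p.2)} ->
  is_matching e' [seq (g p.1, g p.2) | p <- s].
Proof.
move=> us gI es; apply/andP; split; last by apply/allP => _ /mapP[p /es ? ->].
suff -> : endpoints [seq (g p.1, g p.2) | p <- s] = map g (endpoints s).
  by rewrite map_inj_in_uniq.
by elim: s {us gI es} => //= p s; rewrite /endpoints /= => ->.
Qed.

(** * Edge colorings of complete graphs on a list of vertices *)

Record cgraph (T : eqType) := CGraph { verts : seq T; col : T -> T -> nat }.

Definition edge (T : eqType) (G : cgraph T) c : rel T :=
  fun x y => [&& x \in verts G, y \in verts G, x != y & col G x y == c].

Record gallai_cgraph (T : eqType) (k : nat) (G : cgraph T) : Prop := GallaiCGraph {
  verts_uniq : uniq (verts G);
  colC : commutative (col G);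
  col_lt : {in verts G &, forall x y, x != y -> col G x y < k};
  col_gallai : {in verts G & &, forall x y z, uniq [:: x; y; z] ->
    ~~ uniq [:: col G x y; col G y z; col G x z]} }.

Lemma gallai_cgraphW (T : eqType) k l (G : cgraph T) :
  k <= l -> gallai_cgraph k G -> gallai_cgraph l G.
Proof.
by move=> kl [? ? lt ?]; split=> // x y xG yG /(lt x y xG yG)/leq_trans; apply.
Qed.

Lemma edge_ge (T : eqType) k (G : cgraph T) c x y :
  gallai_cgraph k G -> k <= c -> edge G c x y = false.
Proof.
move=> gG kc; apply/negP => /and4P[xG yG xy /eqP Dc].
by have := col_lt gG xG yG xy; rewrite Dc ltnNge kc.
Qed.

Definition clique n c : cgraph nat := CGraph (iota 0 n) (fun _ _ => c).

(** A single vertex has no edges, so for $n \le 1$ the nominal color [c] may be out of range. *)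
Lemma clique_gallai n c k : (1 < n -> c < k) -> gallai_cgraph k (clique n c).
Proof.
move=> ck; split=> //=; rewrite ?iota_uniq //; last first.
  by move=> x y z _ _ _ _; rewrite !inE eqxx.
move=> x y; rewrite !mem_iota /= => xn yn xy; apply: ck.
by case: n xn yn => [|[|n]] //; case: x y xy => [|x] [|y].
Qed.

Lemma clique_deg_le n c c' :
  deg_le (edge (clique n c) c') (if c == c' then n.-1 else 0).
Proof.
move=> v s us es; case: eqP => [_|cc']; last first.
  by case: s us es => //= x s _ /andP[/and4P[_ _ _ /eqP]].
case: s us es => // x s us es.
have vn : v \in iota 0 n by case/andP: es => /and4P[].
suff: size (v :: x :: s) <= size (iota 0 n) by rewrite size_iota; case: n {vn es}.
apply: uniq_leq_size.
  by rewrite cons_uniq us andbT; apply/negP => /(allP es)/and4P[_ _]; rewrite eqxx.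
by move=> y; rewrite in_cons => /predU1P[->//|/(allP es)/and4P[]].
Qed.

Lemma clique_match_le n c c' :
  match_le (edge (clique n c) c') (if c == c' then n./2 else 0).
Proof.
move=> s /andP[us es]; case: eqP => [_|cc']; last first.
  by case: s us es => //= x s _ /andP[/and4P[_ _ _ /eqP]].
rewrite -(doubleK (size s)) -size_endpoints half_leq // -[n in _ <= n](size_iota 0).
apply: uniq_leq_size us _ => x /flattenP[_ /mapP[p /(allP es)/and4P[p1 p2 _ _] ->]].
by rewrite !inE => /orP[] /eqP->.
Qed.

(** * The two complementary 5-cycles of $K_5$ *)

Definition pent_adj i j := (j == i.+1 %% 5) || (i == j.+1 %% 5).

Definition pent_col k i j := if pent_adj i j then k else k.+1.

Definition pent_nbrs k c i :=
  [seq j <- iota 0 5 | (i != j) && (pent_col k i j == c)].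

Lemma pent_colC k : commutative (pent_col k).
Proof. by move=> i j; rewrite /pent_col /pent_adj orbC. Qed.

Lemma pent_col_eq k i j i' j' :
  (pent_col k i j == pent_col k i' j') = (pent_adj i j == pent_adj i' j').
Proof.
rewrite /pent_col; do 2!case: pent_adj; rewrite ?eqxx //.
  by rewrite ltn_eqF.
by rewrite gtn_eqF.
Qed.

Lemma pent_triangle k i j l : i < 5 -> j < 5 -> l < 5 -> uniq [:: i; j; l] ->
  pent_col k i j = pent_col k i l -> pent_col k i j <> pent_col k j l.
Proof.
move=> i5 j5 l5 ijl /eqP + /eqP; rewrite !pent_col_eq; move: i5 j5 l5 ijl.
by case: i => [|[|[|[|[|]]]]]; case: j => [|[|[|[|[|]]]]]; case: l => [|[|[|[|[|]]]]].
Qed.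

Lemma pent_col_gallai k i j l :
  ~~ uniq [:: pent_col k i j; pent_col k j l; pent_col k i l].
Proof.
rewrite /= !inE !pent_col_eq.
by case: (pent_adj i j); case: (pent_adj j l); case: (pent_adj i l).
Qed.

(** * Blow-ups of the pentagon coloring *)

Section Pentagon.
Variables (T : eqType) (k : nat) (G : nat -> cgraph T).

Definition pentagon : cgraph (nat * T)%type :=
  CGraph [seq (i, x) | i <- iota 0 5, x <- verts (G i)]
    (fun u v => if u.1 == v.1 then col (G u.1) u.2 v.2 else pent_col k u.1 v.1).

Lemma mem_pentagon u :
  (u \in verts pentagon) = (u.1 < 5) && (u.2 \in verts (G u.1)).
Proof.
apply/allpairsPdep/andP => [[i [x [i5 xi ->]]]|[u1 u2]].
  by move: i5; rewrite mem_iota.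
by exists u.1, u.2; rewrite mem_iota -surjective_pairing.
Qed.

Lemma size_pentagon : size (verts pentagon) = \sum_(0 <= i < 5) size (verts (G i)).
Proof. by rewrite size_allpairs_dep sumnE big_map. Qed.

(** A triangle inside one part inherits the property from that part; one meeting exactly two parts
    has two outer edges of equal color; one meeting three parts sees only [k] and [k.+1]. *)
Lemma pentagon_gallai K : k.+1 < K ->
  (forall i, gallai_cgraph K (G i)) -> gallai_cgraph K pentagon.
Proof.
move=> kK gG; split.
- apply: allpairs_uniq_dep; rewrite ?iota_uniq //.
    by move=> i _; apply: verts_uniq (gG i).
  by move=> [i x] [j y] _ _ /= [-> ->].
- move=> [i x] [j y] /=; rewrite eq_sym pent_colC.
  by case: eqVneq => // ->; apply: colC (gG i) _ _.
- move=> [i x] [j y]; rewrite !mem_pentagon /= => /andP[i5 xi] /andP[j5 yj].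
  case: (eqVneq i j) => [ij|_ _]; last first.
    by rewrite /pent_col; case: ifP; rewrite ?(ltnW kK).
  by subst j; rewrite xpair_eqE eqxx => xy; apply: col_lt (gG i) _ _ _ _ _.
- move=> [i x] [j y] [l z]; rewrite !mem_pentagon /=.
  move=> /andP[i5 xi] /andP[j5 yj] /andP[l5 zl].
  case: (eqVneq i j) => [ij|ij]; case: (eqVneq j l) => [jl|jl].
  + subst j l; rewrite eqxx /= !inE !xpair_eqE eqxx /=.
    by have := col_gallai (gG i) xi yj zl; rewrite /= !inE.
  + by subst j; rewrite (negPf jl) /= !inE eqxx ?orbT andbF.
  + by subst l; rewrite (negPf ij) pent_colC /= !inE eqxx ?orbT.
  + case: (eqVneq i l) => [il|il]; last by rewrite pent_col_gallai.
    by subst l; rewrite (pent_colC k j) /= !inE eqxx.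
Qed.

Lemma pentagon_edge_in c i x y : i < 5 ->
  edge pentagon c (i, x) (i, y) = edge (G i) c x y.
Proof. by move=> i5; rewrite /edge !mem_pentagon /= i5 eqxx xpair_eqE eqxx. Qed.

Lemma pentagon_edge_out c u v : u.1 != v.1 ->
  edge pentagon c u v =
    [&& u \in verts pentagon, v \in verts pentagon & pent_col k u.1 v.1 == c].
Proof.
by case: u v => [i x] [j y] /= ij; rewrite /edge /= (negPf ij) xpair_eqE (negPf ij).
Qed.

Lemma pentagon_fiber_matching c i s : i < 5 -> is_matching (edge pentagon c) s ->
  {in s, forall p, (p.1.1 == i) && (p.2.1 == i)} ->
  is_matching (edge (G i) c) [seq (p.1.2, p.2.2) | p <- s].
Proof.
move=> i5 /andP[us es] si; apply: (is_matching_map us) => [u v|[u v] p_s].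
  have Hi w : w \in endpoints s -> w.1 = i.
    move=> /flattenP[_ /mapP[p /si/andP[/eqP p1 /eqP p2] ->]].
    by rewrite !inE => /orP[]/eqP->.
  by case: u v => [j x] [l y] /Hi/= -> /Hi/= -> ->.
have := allP es _ p_s; have := si _ p_s; case: u v {p_s} => [j x] [l y] /=.
by case/andP=> /eqP-> /eqP->; rewrite pentagon_edge_in.
Qed.

Lemma pentagon_match_le_sum c J (m : nat -> nat) s :
  (forall j, match_le (edge (G j) c) (m j)) -> is_matching (edge pentagon c) s ->
  {in s, forall p, (p.1.1 == p.2.1) && (p.1.1 \in J)} ->
  size s <= \sum_(j <- J) m j.
Proof.
move=> mG; elim: J s => [|j J IH] s ms sJ.
  by case: s sJ {ms} => // p s /(_ p); rewrite inE eqxx andbF => /(_ isT).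
rewrite big_cons -(count_predC (fun p => p.1.1 == j)) leq_add //.
  rewrite -size_filter.
  (* Only a matching edge inside part [j] shows that $j < 5$; without one there is nothing to
     bound. *)
  have [->//|] := eqVneq (filter (fun p : nat * T * (nat * T) => p.1.1 == j) s) [::].
  rewrite -has_filter => /hasP[p ps /eqP pj].
  have j5 : j < 5.
    by case/andP: ms => _ /allP/(_ p ps)/and4P[]; rewrite mem_pentagon pj => /andP[].
  rewrite -(size_map (fun p => (p.1.2, p.2.2))).
  apply/mG/(pentagon_fiber_matching j5); first exact: is_matching_filter.
  move=> q; rewrite mem_filter => /andP[/eqP qj /sJ/andP[/eqP<- _]].
  by rewrite qj eqxx.
rewrite -size_filter; apply: IH; first exact: is_matching_filter.
by move=> p; rewrite mem_filter => /andP[/= pj /sJ]; rewrite inE (negPf pj).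
Qed.

Lemma pentagon_inner_edge c u v : c \notin [:: k; k.+1] ->
  edge pentagon c u v -> u.1 = v.1.
Proof.
rewrite !inE => /norP[ck ckS]; case: (eqVneq u.1 v.1) => // uv.
rewrite pentagon_edge_out // => /and3P[_ _]; rewrite /pent_col.
by case: pent_adj; rewrite eq_sym ?(negPf ck) ?(negPf ckS).
Qed.

Lemma pentagon_match_le c (m : nat -> nat) : c \notin [:: k; k.+1] ->
  (forall j, match_le (edge (G j) c) (m j)) ->
  match_le (edge pentagon c) (\sum_(0 <= j < 5) m j).
Proof.
move=> ck mG s ms; apply: (pentagon_match_le_sum mG ms) => p ps.
have ep := allP (proj2 (andP ms)) _ ps.
rewrite (pentagon_inner_edge ck ep) eqxx mem_iota.
by case/and4P: ep => _; rewrite mem_pentagon => /andP[].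
Qed.

Lemma pentagon_deg_le_in c d i x (r : seq (nat * T)) : i < 5 ->
  deg_le (edge (G i) c) d -> uniq r ->
  {in r, forall v, (v.1 == i) && edge pentagon c (i, x) v} -> size r <= d.
Proof.
move=> i5 dG ur er; rewrite -(size_map snd); apply: (dG x).
  rewrite map_inj_in_uniq // => -[j y] [l z].
  by move=> /er/andP[/eqP/= -> _] /er/andP[/eqP/= -> _] /= ->.
apply/allP => _ /mapP[[j y] /er/andP[/eqP/= -> ey] ->].
by rewrite -pentagon_edge_in.
Qed.

Lemma pentagon_deg_le c d : c \notin [:: k; k.+1] ->
  (forall j, deg_le (edge (G j) c) d) -> deg_le (edge pentagon c) d.
Proof.
move=> ck dG [i x] r ur er; case: r ur er => // v r ur er.
have i5 : i < 5 by case/andP: er => /and4P[]; rewrite mem_pentagon => /andP[].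
apply: (pentagon_deg_le_in i5 (dG i) ur (x := x)) => w /(allP er) ew.
by rewrite ew andbT -(pentagon_inner_edge ck ew) /=.
Qed.

(** Edges of an inner color never leave a part, so the whole link of [(i, x)] lies in part [i]. *)
Lemma pentagon_fan_le_inner c n : c \notin [:: k; k.+1] ->
  (forall j, fan_le (edge (G j) c) n) -> fan_le (edge pentagon c) n.
Proof.
move=> ck fG [i x] s ms; case: (posnP (size s)) => [->//|s0].
have es p : p \in s -> [&& edge pentagon c (i, x) p.1, edge pentagon c (i, x) p.2
                       & edge pentagon c p.1 p.2].
  exact: (allP (proj2 (andP ms))).
have si p : p \in s -> (p.1.1 == i) && (p.2.1 == i).
  move=> /es/and3P[e1 e2 _].
  by rewrite -(pentagon_inner_edge ck e1) -(pentagon_inner_edge ck e2) eqxx.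
have i5 : i < 5.
  case: s s0 es {ms si} => // p s _ /(_ p (mem_head _ _))/andP[/and4P[]].
  by rewrite mem_pentagon => /andP[].
rewrite -(size_map (fun p => (p.1.2, p.2.2))); apply: (fG i x).
have /andP[us _] : is_matching (edge (G i) c) [seq (p.1.2, p.2.2) | p <- s].
  apply: pentagon_fiber_matching si => //.
  by apply: is_matching_mono ms => p _ /and3P[].
rewrite /is_matching us; apply/allP => _ /mapP[[[j y] [l z]] ps ->].
have /andP[/eqP/= Dj /eqP/= Dl] := si _ ps; subst j l.
by have := es _ ps; rewrite !pentagon_edge_in.
Qed.

Lemma pentagon_fan_le_outer c (d m : nat -> nat) n : c \in [:: k; k.+1] ->
  (forall j, deg_le (edge (G j) c) (d j)) ->
  (forall j, match_le (edge (G j) c) (m j)) ->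
  (forall i, i < 5 -> d i + \sum_(j <- pent_nbrs k c i) m j <= n) ->
  fan_le (edge pentagon c) n.
Proof.
move=> ck dG mG dmn [i x] s ms; case: (posnP (size s)) => [->//|s0].
have /andP[us _] := ms.
have es p : p \in s -> [&& edge pentagon c (i, x) p.1, edge pentagon c (i, x) p.2
                       & edge pentagon c p.1 p.2].
  exact: (allP (proj2 (andP ms))).
have i5 : i < 5.
  case: s s0 es {ms us} => // p s _ /(_ p (mem_head _ _))/andP[/and4P[]].
  by rewrite mem_pentagon => /andP[].
(* Matching edges with an end in part [i] are charged to the degree bound [d i], all others to the
   parts adjacent to [i] in color [c]. *)
pose own (p : nat * T * (nat * T)) := (p.1.1 == i) || (p.2.1 == i).
apply: leq_trans (dmn i i5); rewrite -(count_predC own) leq_add // -size_filter.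
  pose f (p : nat * T * (nat * T)) := if p.1.1 == i then p.1 else p.2.
  rewrite -(size_map f); apply: (pentagon_deg_le_in i5 (dG i) (x := x)).
    apply: uniq_one_endpoint; case/andP: (is_matching_filter own ms) => //.
  move=> _ /mapP[p + ->]; rewrite mem_filter /own /f => /andP[+ /es/and3P[e1 e2 _]].
  by case: eqP => [->|_] /=; [rewrite e1 eqxx|move=> ->; rewrite e2].
apply: (pentagon_match_le_sum mG).
  by apply: is_matching_mono (is_matching_filter _ ms) => p _ /and3P[].
move=> p; rewrite mem_filter => /andP[/norP[p1i p2i] /es/and3P[]].
rewrite !(pentagon_edge_out _ (_ : (i, x).1 != _)) 1?eq_sym //.
rewrite !mem_pentagon /= => /and3P[_ /andP[p15 _] /eqP c1].
move=> /and3P[_ /andP[p25 _] /eqP c2].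
(* Ends in two distinct parts would form, together with [i], a monochromatic triangle of $K_5$. *)
have [p12 _|p12] := eqVneq p.1.1 p.2.1; last first.
  rewrite pentagon_edge_out // => /and3P[_ _ /eqP c12].
  by case: (@pent_triangle k i p.1.1 p.2.1);
    rewrite ?c1 ?c2 ?c12 //= !inE negb_or !(eq_sym i) p1i p2i p12.
by rewrite mem_filter mem_iota eq_sym p1i c1 eqxx.
Qed.

End Pentagon.

(** * From vertex lists to Gallai-Ramsey numbers *)

Lemma eq_set2 (T : finType) (x y a b : T) :
  [set x; y] = [set a; b] -> x != y -> (a, b) = (x, y) \/ (a, b) = (y, x).
Proof.
move=> E; have := set21 x y; have := set22 x y; rewrite E.
by move=> /set2P[] -> /set2P[] ->; rewrite ?eqxx; auto.
Qed.

(** If the number were some $N$ at most the order of [G], the first $N$ vertices of [G] would give a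
    Gallai coloring of $K_N$, and its monochromatic fan a matching of size $n+1$ in a link. *)
Lemma GR_gt (T : eqType) k n (G : cgraph T) : 0 < k -> gallai_cgraph k G ->
  (forall c, fan_le (edge G c) n) -> size (verts G) < GR k (fan n.+1).
Proof.
move=> k0 gG fG; rewrite /GR; case: ex_minnP => N /andP[N0 HN] _.
rewrite ltnNge; apply/negP => leN.
have [x0 _] : exists x0, x0 \in verts G.
  by case: (verts G) leN => [|x r _]; [rewrite leqNgt N0|exists x; rewrite mem_head].
pose h (i : 'I_N) := nth x0 (verts G) i.
have hG i : h i \in verts G by rewrite mem_nth // (leq_trans (ltn_ord i)).
have hE i j : (h i == h j) = (i == j).
  by rewrite nth_uniq ?(verts_uniq gG) // (leq_trans (ltn_ord _)).
pose c0 := Ordinal k0.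
pose tau : coloring k 'I_N := [ffun A =>
  if [pick p : 'I_N * 'I_N | A == [set p.1; p.2]] is Some p
  then insubd c0 (col G (h p.1) (h p.2)) else c0].
have tauE i j : i != j -> val (tau [set i; j]) = col G (h i) (h j).
  move=> ij; rewrite ffunE; case: pickP => [[a b] /= /eqP|/(_ (i, j))]; last first.
    by rewrite eqxx.
  have ltc : col G (h i) (h j) < k by apply: col_lt gG _ _ _ _ _; rewrite ?hE.
  by case/eq_set2 => // -[-> ->]; rewrite ?(colC gG (h j)) val_insubd ltc.
have gtau : gallai tau.
  apply/forallP => x; apply/forallP => y; apply/forallP => z; apply/implyP.
  rewrite /= !inE negb_or !andbT => /andP[/andP[xy xz] yz].
  have := col_gallai gG (hG x) (hG y) (hG z).
  by rewrite /= !inE -!tauE // !val_eqE !hE negb_or xy xz yz !andbT => ->.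
have := implyP (forallP HN tau) gtau.
move=> /existsP[c /existsP[f /andP[/injectiveP fI /forallP fc]]].
pose g p := h (f (Some p)).
have gI : injective g by move=> p q /eqP; rewrite hE => /eqP/fI[].
have fE x y : adj x y -> edge G c (h (f x)) (h (f y)).
  move=> xy; have fxy : f x != f y.
    by rewrite (inj_eq fI); apply: contraTneq xy => ->; rewrite adj_irrefl.
  rewrite /edge !hG hE fxy /= -tauE //.
  by have /forallP/(_ y)/implyP/(_ xy)/eqP-> := fc x.
have /fG : is_matching (link (edge G c) (h (f None)))
    [seq (g (i, false), g (i, true)) | i <- enum 'I_n.+1].
  apply/andP; split; last first.
    by apply/allP => _ /mapP[i _ ->] /=; rewrite /link !fE //= /matching_adj eqxx.
  have -> : endpoints [seq (g (i, false), g (i, true)) | i <- enum 'I_n.+1]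
      = map g [seq (i, b) | i <- enum 'I_n.+1, b <- [:: false; true]].
    by elim: (enum _) => //= i r; rewrite /endpoints /= => ->.
  rewrite map_inj_uniq // allpairs_uniq ?enum_uniq //.
  by move=> [i b] [j b'] _ _ /= [-> ->].
by rewrite size_map size_enum_ord ltnn.
Qed.

(** * Colorings on 13, 14 and 70 vertices *)

(* The triangles of color 0 replace the neighbors of vertex 0 on the 5-cycle of
   color 0, and those of color 1 its neighbors on the 5-cycle of color 1. *)
Definition base n c : cgraph (nat * nat)%type :=
  pentagon 0 (fun i =>
    clique (nth 0 [:: n; 3; 3; 3; 3] i) (nth 0 [:: c; 0; 1; 1; 0] i)).

Lemma size_base n c : size (verts (base n c)) = n + 12.
Proof. by rewrite size_pentagon unlock /= !size_iota. Qed.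

Lemma base_gallai n c k : 1 < k -> (1 < n -> c < k) -> gallai_cgraph k (base n c).
Proof.
move=> k1 ck; apply: pentagon_gallai => // -[|[|[|[|[|i]]]]];
  apply: clique_gallai => //= _; by rewrite ?nth_nil // ltnW.
Qed.

(** A color other than 0 and 1 stays inside cliques of at most 5 vertices. For an outer color, a
    triangle of that color has degree 2 and no edge of that color in the adjacent parts; any other
    part has degree 0 and at most two such triangles adjacent to it. *)
Lemma base_fan_le n c c' : n <= 5 -> 1 < c -> fan_le (edge (base n c) c') 2.
Proof.
move=> n5 c1; have [c01|c01] := boolP (c' \in [:: 0; 1]); last first.
  apply: pentagon_fan_le_inner => // j.
  apply/match_fan_le/(match_leW _ (@clique_match_le _ _ _)).
  case: ifP => // _; case: j => [|[|[|[|[|j]]]]] //=; last by rewrite nth_nil.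
  by rewrite (leq_trans (half_leq n5)).
apply: (pentagon_fan_le_outer c01 (fun=> @clique_deg_le _ _ _)
  (fun=> @clique_match_le _ _ _)).
move: c c1 c01 => [|[|c]] // _; rewrite !inE => /orP[] /eqP-> [|[|[|[|[|i]]]]] // _;
  by rewrite /pent_nbrs /= !(big_cons, big_nil).
Qed.

(** Beyond colors 0 and 1 only the edge in part 0 remains, of color [c]; the boolean bound is read
    as 0 or 1. *)
Lemma base_deg_le c c' : 1 < c' -> deg_le (edge (base 2 c) c') (c == c').
Proof.
case: c' => [|[|c']] // _; apply: pentagon_deg_le => // j.
apply: deg_leW (@clique_deg_le _ _ _).
by case: j => [|[|[|[|[|j]]]]] //=; rewrite ?nth_nil //; case: eqP.
Qed.

Lemma base_match_le c c' : 1 < c' -> match_le (edge (base 2 c) c') (c == c').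
Proof.
case: c' => [|[|c']] // _; apply: match_leW (pentagon_match_le _ _) => //; last first.
  by move=> j; apply: clique_match_le.
by rewrite unlock /= addn0; case: eqP.
Qed.

(** The list gives the colors of the exceptional edges. The fan bound fails only if some part and
    both its neighbors on the 5-cycle of color $c$ have entry $c$. Color 2 sits at 0, 1, 3, not
    consecutive on its cycle, and color 3 occurs only twice. *)
Definition base70 : cgraph (nat * (nat * nat))%type :=
  pentagon 2 (fun i => base 2 (nth 2 [:: 2; 2; 3; 2; 3] i)).

Lemma size_base70 : size (verts base70) = 70.
Proof.
rewrite size_pentagon (eq_bigr (fun=> 14)) => [|i _]; last exact: size_base.
by rewrite sum_nat_const_nat.
Qed.

(** [pentagon_gallai] quantifies over all natural [i], so the default of [nth] must be in range
    too. *)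
Lemma base70_color i : 1 < nth 2 [:: 2; 2; 3; 2; 3] i < 4.
Proof. by case: i => [|[|[|[|[|i]]]]] //=; rewrite nth_nil. Qed.

Lemma base70_gallai : gallai_cgraph 4 base70.
Proof.
apply: pentagon_gallai => // i; apply: base_gallai => // _.
by case/andP: (base70_color i).
Qed.

Lemma base70_fan_le c : fan_le (edge base70 c) 2.
Proof.
have [c23|c23] := boolP (c \in [:: 2; 3]); last first.
  apply: pentagon_fan_le_inner => // i; apply: base_fan_le => //.
  by case/andP: (base70_color i).
have c1 : 1 < c by move: c23; rewrite !inE => /orP[]/eqP->.
apply: (pentagon_fan_le_outer c23 (fun=> base_deg_le c1)
  (fun=> base_match_le c1)).
move: c23 {c1}; rewrite !inE => /orP[] /eqP-> [|[|[|[|[|i]]]]] // _;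
  by rewrite /pent_nbrs /= !(big_cons, big_nil).
Qed.

(** * Iterated blow-ups and the lower bound *)

Lemma fan3_free_gallai t : exists (T : eqType) (G : cgraph T),
  [/\ gallai_cgraph (t.*2 + 4) G, forall c, fan_le (edge G c) 2
    & size (verts G) = 14 * 5 ^ t.+1].
Proof.
elim: t => [|t [T [G [gG fG sG]]]].
  exists _, base70; split; last exact: size_base70.
    exact: base70_gallai.
  exact: base70_fan_le.
pose k := t.*2 + 4.
exists _, (pentagon k (fun=> G)); split.
- apply: pentagon_gallai => // _.
  by apply: gallai_cgraphW gG; rewrite doubleS !addSn ltnW.
- move=> c; have [ck|ck] := boolP (c \in [:: k; k.+1]); last first.
    exact: pentagon_fan_le_inner.
  (* The two new colors do not occur inside the copies of [G], so all inner bounds are 0. *)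
  have eF x y : edge G c x y = false.
    by apply: edge_ge gG _; move: ck; rewrite !inE => /orP[]/eqP->.
  apply: (pentagon_fan_le_outer (d := fun=> 0) (m := fun=> 0) ck).
  + by move=> _ v [|w r] //= _; rewrite eF.
  + by move=> _ [|p s] //= /andP[_] /=; rewrite eF.
  + by move=> i _; rewrite big1.
- by rewrite size_pentagon sum_nat_const_nat sG mulnCA (expnS 5 t.+1).
Qed.

Theorem theorem2 (k : nat) (k_ge2 : 2 <= k) (k_even : ~~ odd k) :
  (if k == 2 then 14 else 14 * 5 ^ ((k - 2) %/ 2) + 1) <= GR k (fan 3).
Proof.
case: eqP => [->|k2].
  (* With a single vertex as first part, its nominal color 2 colors no edge, so two colors
     suffice. *)
  rewrite -[14]/(1 + 12).+1 -(size_base 1 2).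
  by apply: GR_gt => [//||c]; [apply: base_gallai | apply: base_fan_le].
have [t Dk] : exists t, k = t.*2 + 4.
  exists (k - 4)./2; rewrite -[k in LHS](@subnK 4) ?even_halfK //.
    by rewrite oddB ?(negPf k_even) //; case: k k_ge2 k_even k2 => [|[|[|[|k]]]].
  by case: k k_ge2 k_even k2 => [|[|[|[|k]]]].
have [T [G [gG fG sG]]] := fan3_free_gallai t.
rewrite Dk -addnBA // divn2 halfD /= odd_double doubleK addn1 add0n addn1 -sG.
by apply: GR_gt => //; rewrite addnS.
Qed.
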